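(* Let $d\ge 3$ and $m\ge 2$ be integers. For $1\le k\le m$ let $u_k=x_1^{d-r_k}x_2^{r_k-1}x_{i_k}$, where $1\le r_k\le d$ and $2\le i_k\le n$, and let $I=B(u_1,\ldots,u_m)$ be the Borel ideal of degree $d$ with Borel generators $u_1,\ldots,u_m$. Then $I$ is Freiman.
   Context: Throughout, $n\ge 3$ is an integer, $K$ is a field, $S=K[x_1,\ldots,x_n]$ is the polynomial ring and $\mathfrak m=(x_1,\ldots,x_n)$. For a monomial ideal $I\subset S$, $G(I)$ is its unique minimal set of monomial generators and $\mu(I)=|G(I)|$. $I$ is equigenerated if all elements of $G(I)$ have the same degree. The analytic spread $\ell(I)$ is the Krull dimension of the fiber ring $F(I)=\bigoplus_{k\ge 0}I^k/\mathfrak m I^k$. An equigenerated monomial ideal $I$ is called Freiman if $\mu(I^2)=\ell(I)\mu(I)-\binom{\ell(I)}{2}$. For a monomial $u$, $\mathrm{supp}(u)=\{i: x_i\mid u\}$. A monomial ideal $I$ is Borel if for every $u\in G(I)$, every $j\in\mathrm{supp}(u)$ and every $i<j$ one has $x_i(u/x_j)\in I$. For monomials $u_1,\ldots,u_m$, $B(u_1,\ldots,u_m)$ denotes the unique smallest (with respect to inclusion) Borel ideal containing $u_1,\ldots,u_m$, and $u_1,\ldots,u_m$ are called its Borel generators. *)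

(* Defs.v *)
From HB Require Import structures.
From mathcomp Require Import all_boot all_order all_algebra.
From mathcomp Require Import finmap ring_quotient mpoly.
From mathcomp Require Import boolp classical_sets cardinality.

Set Implicit Arguments.
Unset Strict Implicit.
Unset Printing Implicit Defensive.

Import GRing.Theory.
Local Open Scope classical_set_scope.
Local Open Scope ring_scope.

Section Ideals.
Variable R : comNzRingType.
Implicit Types (I J A : set R) (p q : {poly R}).

(* Unlike [idealr_closed], the unit ideal is allowed: it is needed as I ^ 0. *)
Definition is_ideal I : Prop :=
  [/\ I 0, forall x y, I x -> I y -> I (x + y) & forall a x, I x -> I (a * x)].

Definition ideal_gen A : set R := smallest is_ideal A.

Definition ideal_mul I J : set R := ideal_gen [set x * y | x in I & y in J].

Definition ideal_pow I k : set R := iter k (ideal_mul I) setT.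

Lemma is_idealT : is_ideal setT. Proof. by []. Qed.

Lemma ideal_genP A : is_ideal (ideal_gen A).
Proof.
split=> [J [[]]//|x y Ax Ay J [J_ AJ]|a x Ax J [J_ AJ]].
  by case: (J_) => _ + _; apply; [exact: Ax|exact: Ay].
by case: (J_) => _ _; apply; exact: Ax.
Qed.

Lemma ideal_mulP I J : is_ideal (ideal_mul I J).
Proof. exact: ideal_genP. Qed.

Lemma ideal_powP I k : is_ideal (ideal_pow I k).
Proof. by case: k => [|k]; [exact: is_idealT|exact: ideal_mulP]. Qed.

Lemma ideal_mul_mem I J x y : I x -> J y -> ideal_mul I J (x * y).
Proof. by move=> Ix Jy; apply: sub_gen_smallest; exists x => //; exists y. Qed.

Lemma ideal_mul_sub I J L : is_ideal L ->
  (forall x y, I x -> J y -> L (x * y)) -> ideal_mul I J `<=` L.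
Proof.
by move=> L_ IJL; apply: smallest_sub => // _ [x Ix] [y Jy <-]; apply: IJL.
Qed.

Lemma ideal_quotient J y : is_ideal J -> is_ideal [set x | J (x * y)].
Proof.
case=> J0 JD JM; split=> /= [|x x' Jx Jx'|a x Jx]; first by rewrite mul0r.
- by rewrite mulrDl; apply: JD.
- by rewrite -mulrA; apply: JM.
Qed.

Lemma ideal_powD I j k x y :
  ideal_pow I j x -> ideal_pow I k y -> ideal_pow I (j + k) (x * y).
Proof.
move=> + Iy; elim: j x => [|j IHj] x Ix.
  by have [_ _] := ideal_powP I k; apply.
rewrite addSn.
suff /(_ x Ix) : ideal_pow I j.+1 `<=` [set x | ideal_pow I (j + k).+1 (x * y)].
  by [].
apply: ideal_mul_sub; first exact/ideal_quotient/ideal_powP.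
by move=> a b Ia Ib /=; rewrite -mulrA; apply: ideal_mul_mem => //; apply: IHj.
Qed.

Lemma ideal_mul_powD M I j k x y :
  ideal_pow I j x -> ideal_mul M (ideal_pow I k) y ->
  ideal_mul M (ideal_pow I (j + k)) (x * y).
Proof.
move=> Ix My; rewrite mulrC; move: y My.
apply: ideal_mul_sub; first exact/ideal_quotient/ideal_mulP.
move=> a b Ma Ib /=; rewrite -mulrA; apply: ideal_mul_mem => //.
by rewrite mulrC; apply: ideal_powD.
Qed.

Lemma is_ideal_sum J (T : Type) (s : seq T) (P : pred T) (F : T -> R) :
  is_ideal J -> (forall t, P t -> J (F t)) -> J (\sum_(t <- s | P t) F t).
Proof. by case=> J0 JD _ JF; elim/big_ind: _. Qed.

Lemma is_idealN J x : is_ideal J -> J x -> J (- x).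
Proof. by case=> _ _ JM Jx; rewrite -mulN1r; apply: JM. Qed.

Definition rees_pred I : {pred {poly R}} :=
  [pred p : {poly R} | `[< forall k, ideal_pow I k p`_k >]].

Lemma rees_predP I p : reflect (forall k, ideal_pow I k p`_k) (p \in rees_pred I).
Proof. exact: asboolP. Qed.

Lemma rees_pred_subring I : subring_closed (rees_pred I).
Proof.
split=> [|p q /rees_predP Ip /rees_predP Iq|p q /rees_predP Ip /rees_predP Iq].
- apply/rees_predP => k; rewrite coef1.
  by case: k => [|k] //=; case: (ideal_powP I k.+1).
- apply/rees_predP => k; rewrite coefB.
  have [_ ID _] := ideal_powP I k.
  by apply: ID => //; apply: is_idealN => //; apply: ideal_powP.
- apply/rees_predP => k; rewrite coefM.
  apply: is_ideal_sum => [|j _]; first exact: ideal_powP.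
  by rewrite -[X in ideal_pow _ X](subnKC (leq_ord j)); apply: ideal_powD.
Qed.

HB.instance Definition _ I :=
  GRing.isSubringClosed.Build {poly R} (rees_pred I) (rees_pred_subring I).

(* The Rees algebra, i.e. the direct sum of the I ^ k, realized as the subring
   of R[t] of the polynomials whose coefficient of t ^ k lies in I ^ k. *)
Record rees I := Rees { rees_val :> {poly R}; _ : rees_val \in rees_pred I }.

HB.instance Definition _ I := [isSub for @rees_val I].
HB.instance Definition _ I := [Choice of rees I by <:].
HB.instance Definition _ I := [SubChoice_isSubComNzRing of rees I by <:].

Lemma rees_coef I (p : rees I) k : ideal_pow I k (rees_val p)`_k.
Proof. exact: (rees_predP _ _ (valP p)). Qed.

End Ideals.

Section KrullDimension.
Variable R : comNzRingType.

Definition prime_ideal (P : {pred R}) : Prop :=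
  idealr_closed P /\ prime_idealr_closed P.

Definition prime_chain (d : nat) : Prop :=
  exists P : 'I_d.+1 -> {pred R}, (forall i, prime_ideal (P i)) /\
    forall i j : 'I_d.+1, (i < j)%N ->
      {subset P i <= P j} /\ ~ {subset P j <= P i}.

Definition krull_dim (d : nat) : Prop :=
  prime_chain d /\ forall e, prime_chain e -> (e <= d)%N.

End KrullDimension.

Section MonomialIdeals.
Variables (K : fieldType) (n : nat).
Local Notation S := {mpoly K[n]}.
Implicit Types (I J : set S) (G A : set 'X_{1..n}) (u v a : 'X_{1..n}).

Definition mon_ideal A : set S := ideal_gen [set 'X_[K, a] | a in A].

Definition monomial_ideal I : Prop := exists A, I = mon_ideal A.

Definition is_mingens I G : Prop :=
  mon_ideal G = I /\ forall H, H `<=` G -> mon_ideal H = I -> H = G.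

(* G(I); see [mingensP] and [mingens_uniq] for existence and uniqueness. *)
Definition mingens I : set 'X_{1..n} := xget set0 (is_mingens I).

(* [fset_set] is the empty set on infinite sets, but G(I) is finite (Dickson). *)
Definition mu I : nat := #|` fset_set (mingens I)|%fset.

Definition equigenerated I : Prop :=
  exists d, forall u, mingens I u -> mdeg u = d.

Definition maxid : set S := ideal_gen [set 'X_i | i in [set: 'I_n]].

(* F(I), as the quotient of the Rees algebra by the sum of the m * I ^ k. *)
Definition fiber_ideal I : {pred rees I} :=
  [pred p : rees I |
    `[< forall k, ideal_mul maxid (ideal_pow I k) (rees_val p)`_k >]].

Arguments fiber_ideal : clear implicits.

Lemma fiber_idealP I (p : rees I) :
  reflect (forall k, ideal_mul maxid (ideal_pow I k) (rees_val p)`_k)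
          (p \in fiber_ideal I).
Proof. exact: asboolP. Qed.

Lemma maxid_eval0 (p : S) : maxid p -> meval (fun=> 0) p = 0.
Proof.
have ev0 : is_ideal [set p : S | meval (fun=> 0) p = 0].
  split=> /= [|p1 p2 p10 p20|a q q0]; first by rewrite meval0.
  - by rewrite mevalD p10 p20 addr0.
  - by rewrite mevalM q0 mulr0.
move: p; apply: smallest_sub => // _ [i _ <-] /=; exact: mevalXU.
Qed.

Lemma fiber_ideal_closed I : idealr_closed (fiber_ideal I).
Proof.
split.
- by apply/fiber_idealP => k; rewrite coef0; case: (ideal_mulP maxid (ideal_pow I k)).
- apply/negP => /fiber_idealP/(_ 0%N); rewrite /= coef1 /= => h1.
  suff : maxid 1 by move/maxid_eval0; rewrite meval1 => /eqP; rewrite oner_eq0.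
  have [m0 mD mM] : is_ideal maxid by exact: ideal_genP.
  move: h1; apply: ideal_mul_sub => //.
  by move=> x y mx _; rewrite mulrC; apply: mM.
- move=> a p q /fiber_idealP Ip /fiber_idealP Iq; apply/fiber_idealP => k.
  rewrite /= coefD; have [_ ID _] := ideal_mulP maxid (ideal_pow I k).
  apply: ID => //; rewrite coefM.
  apply: is_ideal_sum => [|j _]; first exact: ideal_mulP.
  rewrite -[X in ideal_pow _ X](subnKC (leq_ord j)).
  by apply: ideal_mul_powD => //; apply: rees_coef.
Qed.

HB.instance Definition _ I :=
  isIdealr.Build (rees I) (fiber_ideal I) (fiber_ideal_closed I).

Definition fiber_ring I : comNzRingType := {ideal_quot (fiber_ideal I)}.

Definition analytic_spread I (l : nat) : Prop := krull_dim (fiber_ring I) l.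

Definition freiman I : Prop :=
  [/\ monomial_ideal I, equigenerated I &
      exists2 l, analytic_spread I l &
        (mu (ideal_pow I 2))%:Z = (l * mu I)%:Z - 'C(l, 2)%:Z].

Definition borel I : Prop :=
  monomial_ideal I /\
  forall u, mingens I u -> forall i j : 'I_n, (0 < u j)%N -> (i < j)%N ->
    I 'X_[u - U_(j) + U_(i)].

(* B(A); see [borel_hullP]. *)
Definition borel_hull A : set S := smallest borel [set 'X_[K, a] | a in A].

(* x_i, with the variables numbered from 1. *)
Definition xvar (i : nat) : 'X_{1..n} := [multinom nat_of_bool (j.+1 == i) | j < n].

Lemma mon_idealP A (p : S) :
  mon_ideal A p <-> forall u, u \in msupp p -> exists2 a, A a & (a <= u)%MM.
Proof.
split=> [|Ap].
  move: p; apply: smallest_sub.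
    split=> [u|p q Ap Aq u|p q Aq u]; first by rewrite msupp0.
    - by move/msuppD_le; rewrite mem_cat => /orP[/Ap|/Aq].
    - move/msuppM_le/allpairsP => [[a b] /= [_ /Aq [c Ac cb] ->]].
      by exists c => //; apply: lepm_trans cb _; exact: lem_addl.
  move=> _ [a Aa <-] u; rewrite msuppX inE => /eqP ->.
  by exists a => //; apply: lepm_refl.
rewrite [p]mpolyE; rewrite big_seq; apply: is_ideal_sum => [|u /Ap [a Aa au]].
  exact: ideal_genP.
have [_ _ AM] := ideal_genP [set 'X_[K, a] | a in A].
rewrite -(submK au) mpolyXD scalerAl; apply: AM.
by apply: sub_gen_smallest; exists a.
Qed.


Lemma mon_idealX A u : mon_ideal A 'X_[u] <-> exists2 a, A a & (a <= u)%MM.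
Proof.
split=> [/mon_idealP/(_ u)|Au]; first by rewrite msuppX inE eqxx; apply.
by apply/mon_idealP => v; rewrite msuppX inE => /eqP ->.
Qed.

Lemma mon_ideal_mono A A' : A `<=` A' -> mon_ideal A `<=` mon_ideal A'.
Proof.
move=> AA' p /mon_idealP Ap; apply/mon_idealP => u /Ap[a /AA' ? ?].
by exists a.
Qed.

Lemma monomial_idealP I :
  monomial_ideal I <->
  is_ideal I /\ forall p u, I p -> u \in msupp p -> I 'X_[u].
Proof.
split=> [[A ->]|[I_ IX]].
  split=> [|p u /mon_idealP Ap /Ap Au]; first exact: ideal_genP.
  exact/mon_idealX.
exists [set u | I 'X_[u]]; apply/seteqP; split=> [p Ip|].
  by apply/mon_idealP => u up; exists u; [exact: IX up|exact: lepm_refl].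
by apply: smallest_sub => // _ [u Iu <-].
Qed.

Lemma monomial_ideal_le I u v :
  monomial_ideal I -> I 'X_[u] -> (u <= v)%MM -> I 'X_[v].
Proof.
move=> /monomial_idealP[[_ _ IM] _] Iu uv.
by rewrite -(submK uv) mpolyXD; apply: IM.
Qed.

Definition minmons I : set 'X_{1..n} :=
  [set u | I 'X_[u] /\ forall v, I 'X_[v] -> (v <= u)%MM -> v = u].

Lemma minmons_below I u : I 'X_[u] -> exists2 v, minmons I v & (v <= u)%MM.
Proof.
have [k] := ubnP (mdeg u); elim: k u => // k IHk u /ltnSE uk Iu.
have [[v [Iv vu vNu]]|Nv] :=
    pselect (exists v, [/\ I 'X_[v], (v <= u)%MM & v <> u]).
  have vltu : (mdeg v < mdeg u)%N.
    rewrite -(submK vu) mdegD -[X in (X < _)%N]add0n ltn_add2r lt0n mdeg_eq0.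
    by apply/eqP => uv0; apply: vNu; rewrite -(submK vu) uv0 add0m.
  have [w Iw wv] := IHk v (leq_trans vltu uk) Iv.
  by exists w => //; apply: lepm_trans wv vu.
exists u; last exact: lepm_refl.
split=> // v Iv vu; apply: contrapT => vNu; apply: Nv.
by exists v.
Qed.

Lemma mon_ideal_minmons I : monomial_ideal I -> mon_ideal (minmons I) = I.
Proof.
move=> Imon; have [I_ IX] := (monomial_idealP I).1 Imon.
apply/seteqP; split; first by apply: smallest_sub => // _ [u [Iu _] <-].
by move=> p Ip; apply/mon_idealP => u /(IX _ _ Ip)/minmons_below.
Qed.

Lemma minmons_sub I G : mon_ideal G = I -> minmons I `<=` G.
Proof.
move=> <- u [/mon_idealX[a Ga au] umin].
rewrite -(umin a) //; apply/mon_idealX; exists a => //; exact: lepm_refl.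
Qed.

Lemma is_mingens_minmons I : monomial_ideal I -> is_mingens I (minmons I).
Proof.
move=> Imon; split=> [|H HI HE]; first exact: mon_ideal_minmons.
by apply/seteqP; split=> //; apply: minmons_sub.
Qed.

Lemma mingens_uniq I G G' : is_mingens I G -> is_mingens I G' -> G = G'.
Proof.
move=> GI G'I; have Imon : monomial_ideal I by exists G; case: GI.
have IE := mon_ideal_minmons Imon.
case: GI => /[dup] GE /minmons_sub GI /(_ _ GI IE) <-.
by case: G'I => /[dup] G'E /minmons_sub G'I /(_ _ G'I IE) <-.
Qed.

Lemma mingensP I : monomial_ideal I -> is_mingens I (mingens I).
Proof. by move=> /is_mingens_minmons /(xgetI set0). Qed.

Lemma mingensE I : monomial_ideal I -> mingens I = minmons I.
Proof.
move=> Imon.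
by apply: mingens_uniq; [exact: mingensP|exact: is_mingens_minmons].
Qed.

Lemma borelP I :
  borel I <-> monomial_ideal I /\ forall u, I 'X_[u] ->
    forall i j : 'I_n, (0 < u j)%N -> (i < j)%N -> I 'X_[u - U_(j) + U_(i)].
Proof.
split=> -[Imon IB]; split=> // u; last first.
  by rewrite mingensE // => -[Iu _] i j; apply: IB.
move=> Iu i j uj ij; have [g Ig gu] := minmons_below Iu.
have gule k : (g k <= u k)%N by exact: mnm_lepP gu k.
have [gj|] := posnP (g j).
  apply: (monomial_ideal_le Imon Ig.1); apply/mnm_lepP => k.
  rewrite mnmDE mnmBE !mnm1E; case: eqVneq => [<-|_]; first by rewrite gj.
  by rewrite subn0 (leq_trans (gule k)) ?leq_addr.
rewrite -mingensE // in Ig; move=> gj.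
apply: (monomial_ideal_le Imon (IB g Ig i j gj ij)); apply/mnm_lepP => k.
by rewrite !mnmDE !mnmBE leq_add2r leq_sub2r.
Qed.

(* B(A) is the unique smallest Borel ideal containing A. *)
Lemma borel_hullP A I :
  I = borel_hull A <->
  [/\ borel I, forall a, A a -> I 'X_[a] &
      forall J, borel J -> (forall a, A a -> J 'X_[a]) -> I `<=` J].
Proof.
have hullB : borel (borel_hull A).
  apply/borelP; split=> [|u Iu i j uj ij J /= [JB AJ]]; last first.
    by apply: ((borelP J).1 JB).2 => //; apply: Iu; split.
  apply/monomial_idealP; split=> [|p u Ip up J /= [JB AJ]]; last first.
    have [_ JX] := (monomial_idealP J).1 JB.1.
    by apply: JX up; apply: Ip; split.
  split=> [J [JB AJ]|x y Ix Iy J [JB AJ]|a x Ix J [JB AJ]];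
    have [[J0 JD JM] _] := (monomial_idealP J).1 JB.1 => //.
  - by apply: JD; [apply: Ix|apply: Iy]; split.
  - by apply: JM; apply: Ix; split.
have hullA a : A a -> borel_hull A 'X_[a].
  by move=> Aa; apply: sub_gen_smallest; exists a.
have hullS J : borel J -> (forall a, A a -> J 'X_[a]) -> borel_hull A `<=` J.
  by move=> JB AJ; apply: smallest_sub => // _ [a Aa <-]; apply: AJ.
split=> [->|[IB IA IS]]; first by split.
by apply/seteqP; split; [exact: IS|exact: hullS].
Qed.

End MonomialIdeals.

Arguments fiber_ideal {K n} I.
Arguments borel_hull K {n} A.
Arguments xvar n i : clear implicits.

(* Main.v *)
Require Import Defs.
From HB Require Import structures.
From mathcomp Require Import all_boot all_order all_algebra.
From mathcomp Require Import finmap ring_quotient mpoly zify.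
From mathcomp Require Import boolp classical_sets cardinality.

(** All generators of I have degree d, so nothing is lost by putting x_1 = 1.
    The generators of I then become the monomials x_2^b y_s, where y_0 = 1 and
    y_s = x_(s+2) for 0 < s < L, and where b runs over 0 <= b < w_s for certain
    column heights w_s > 0; the number L + 1 is the largest index of a variable
    that occurs in I. Indeed a Borel ideal generated in one degree consists of
    what lies below its Borel generators in the Borel order (for every t,
    compare the degrees in x_t, ..., x_n), and below x_1^(d-r) x_2^(r-1) x_i the
    exponents of x_3, ..., x_n add up to at most 1 ([borel_hull_equigen],
    [borel_below_generators_stair]). So w_s is the maximum of the r_k over the k
    with i_k >= s + 2, plus 1 when s = 0, since y_0 takes up no degree.

    The generators of I^2 are then the x_2^b y_s y_t with s <= t, and since
    intervals add to intervals, b runs exactly over 0 <= b < w_s + w_t - 1. With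
    W the sum of the w_s this gives mu(I) = W and
      mu(I^2) = sum over s <= t < L of (w_s + w_t - 1) = (L + 1) W - C(L + 1, 2)
    ([msumset_stair], [sum_triangle], [mu_stair], [mu_stair2]). This is the
    Freiman equality, provided that the analytic spread of I is L + 1.

    For the analytic spread, taking in the coefficient of t^k the component of
    degree dk identifies the fiber ring of an ideal generated by monomials of
    degree d > 0 with the subring of S generated by these monomials
    ([fiber_map_eq0]). Its Krull dimension is the number l of variables that
    occur, as soon as each of them is the last variable of some generator
    ([analytic_spread_mon_ideal]):
    - setting to 0 the last variables, one more at a time, yields a strict chain
      of l + 1 primes;
    - any l + 1 polynomials in l variables are algebraically dependent over K,
      because they have more monomials of bounded exponents than there are
      coefficients in them ([mpoly_alg_dep]), and a relation
      Q(f_0, ..., f_l) = 0 with Q nonzero is incompatible with primes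
      P_0 < ... < P_(l+1) such that f_i lies in P_(i+1) but not in P_i
      ([relation_in_chain]). *)
Set Implicit Arguments.
Unset Strict Implicit.
Unset Printing Implicit Defensive.
Import GRing.Theory.

(** * Lengths of chains of prime ideals *)

Section KrullBounds.
Local Open Scope quotient_scope.
Local Open Scope ring_scope.

Lemma prime_ideal_exp (R : comNzRingType) (P : {pred R}) x y k :
  prime_ideal P -> x \notin P -> x ^+ k * y \in P -> y \in P.
Proof.
move=> [_ Pprime] xNP; elim: k => [|k IHk]; first by rewrite mul1r.
by rewrite exprS -mulrA => /Pprime; rewrite (negPf xNP) /= => /IHk.
Qed.

Lemma prime_idealM (R : comNzRingType) (P : {pred R}) a x :
  prime_ideal P -> x \in P -> a * x \in P.
Proof. by move=> [[P0 _ PD] _] xP; rewrite -[a * x]addr0 PD. Qed.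

Lemma prime_idealB (R : comNzRingType) (P : {pred R}) x y :
  prime_ideal P -> x \in P -> y \in P -> x - y \in P.
Proof. by move=> [[P0 _ PD] _] xP yP; rewrite addrC -mulN1r PD. Qed.

(** Among the exponent vectors u of Q, keep those whose coordinates 0, 1, ...
    are successively minimal. At stage i the sum of the terms
    c(Q_u) f_i^(u_i) f_(i+1)^(u_(i+1)) ... over the vectors still kept lies in
    P_i: one divides it by the largest possible power of f_i, which is allowed
    as f_i is not in the prime P_i, and drops the terms that still contain f_i,
    which is allowed in P_(i+1). At the end a single vector is left, and a
    nonzero constant would lie in P_m. *)
Lemma relation_in_chain (K : fieldType) (R : comNzRingType)
    (c : {rmorphism K -> R}) m (P : nat -> {pred R}) (f : 'I_m -> R)
    (Q : {mpoly K[m]}) :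
  (forall i, (i <= m)%N -> prime_ideal (P i)) ->
  (forall i, (i < m)%N -> {subset P i <= P i.+1}) ->
  (forall i : 'I_m, f i \notin P i) -> (forall i : 'I_m, f i \in P i.+1) ->
  Q != 0 -> mmap c f Q \notin P 0%N.
Proof.
move=> Pprime Psub fNP fP Q0; apply/negP => Qf0.
pose S i (T : seq 'X_{1..m}) :=
  \sum_(u <- T) c Q@_u * \prod_(j < m | (i <= j)%N) f j ^+ u j.
have stage i : (i <= m)%N -> exists T, [/\ uniq T, T != [::],
    {subset T <= msupp Q}, S i T \in P i
  & forall u v, u \in T -> v \in T -> forall j : 'I_m, (j < i)%N -> u j = v j].
  elim: i => [_|i IHi lt_im].
    exists (msupp Q); split=> //; first by rewrite msupp_eq0.
  have [T [Tuniq T0 TQ ST TE]] := IHi (ltnW lt_im).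
  pose o := Ordinal lt_im.
  have exk : exists k, has (fun u : 'X_{1..m} => u o == k) T.
    case: T T0 {Tuniq TQ ST TE} => // u T _; exists (u o).
    by rewrite /= eqxx.
  case: (ex_minnP exk) => k /hasP[u0 u0T /eqP u0k] kmin.
  have kle u : u \in T -> (k <= u o)%N.
    by move=> uT; apply: kmin; apply/hasP; exists u.
  exists [seq u : 'X_{1..m} <- T | u o == k]; split.
  - exact: filter_uniq.
  - by apply/eqP => E; have := in_nil u0; rewrite -E mem_filter u0T u0k eqxx.
  - by move=> u; rewrite mem_filter => /andP[_ /TQ].
  - rewrite /S big_filter.
    pose X (u : 'X_{1..m}) := c Q@_u * \prod_(j < m | (i.+1 <= j)%N) f j ^+ u j.
    pose Y := \sum_(u <- T | (u : 'X_{1..m}) o != k) f o ^+ (u o - k).-1 * X u.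
    have split_power (u : 'X_{1..m}) : u \in T -> u o != k ->
        f o ^+ u o * X u = f o ^+ k * (f o ^+ (u o - k).-1 * X u * f o).
      move=> uT uk; have uE : u o = (k + (u o - k).-1.+1)%N.
        by rewrite prednK ?subnKC ?subn_gt0 ?kle // ltn_neqAle eq_sym uk kle.
      by rewrite {1}uE exprD exprSr -!mulrA [f o * X u]mulrC /X -!mulrA.
    have SE : S i T =
        f o ^+ k * (\sum_(u <- T | (u : 'X_{1..m}) o == k) X u + Y * f o).
      rewrite /S (bigID (fun u : 'X_{1..m} => u o == k)) /= mulrDr.
      have XE (u : 'X_{1..m}) : c Q@_u * \prod_(j < m | (i <= j)%N) f j ^+ u j
                  = f o ^+ u o * X u.
        rewrite (bigD1 o) //= mulrCA; congr (_ * (_ * _)).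
        by apply: eq_bigl => j; rewrite -val_eqE /= ltn_neqAle eq_sym andbC.
      congr (_ + _).
        by rewrite mulr_sumr; apply: eq_bigr => u /eqP uk; rewrite XE uk.
      rewrite mulr_suml mulr_sumr big_seq_cond [RHS]big_seq_cond.
      by apply: eq_bigr => u /andP[uT uk]; rewrite XE; apply: split_power.
    have := ST; rewrite SE => /(prime_ideal_exp (Pprime _ (ltnW lt_im)) (fNP o)).
    move=> /(Psub _ lt_im) SP; have P1 := Pprime _ lt_im.
    rewrite -[X in X \in _](addrK (Y * f o)).
    by apply: prime_idealB => //; apply: prime_idealM => //; apply: fP.
  - move=> u v; rewrite !mem_filter => /andP[/eqP uk uT] /andP[/eqP vk vT] j.
    rewrite ltnS leq_eqVlt => /predU1P[ji|]; last exact: TE.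
    by have -> : j = o by [apply: val_inj]; rewrite uk vk.
have [T [Tuniq T0 TQ ST TE]] := stage m (leqnn m).
have Pm := Pprime m (leqnn m).
have [u TEu] : exists u, T = [:: u].
  case: T T0 Tuniq TE {TQ ST} => // u T _ /= /andP[uT _] TE; exists u.
  case: T uT TE => // v T; rewrite inE => /norP[/eqP uv _] TE; case: uv.
  apply/mnmP => j.
  by apply: TE (ltn_ord j); rewrite !inE eqxx ?orbT.
move: ST (TQ u); rewrite {}TEu /S big_seq1 big_pred0; last first.
  by move=> j; rewrite leqNgt ltn_ord.
rewrite mulr1 inE eqxx mcoeff_msupp => cP /(_ isT) Qu.
have [[_ P1 _] _] := Pm; move/negP: P1; apply.
rewrite -(rmorph1 c) -(mulVf Qu) rmorphM.
exact: prime_idealM.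
Qed.

(** A chain that is too long provides elements f_i in P_(i+1) but not in P_i,
    to which [relation_in_chain] applies. *)
Lemma prime_chain_leq (K : fieldType) (R : comNzRingType)
    (c : {rmorphism K -> R}) l :
  (forall f : 'I_l.+1 -> R, exists2 Q : {mpoly K[l.+1]},
     Q != 0 & mmap c f Q = 0) ->
  forall e, prime_chain R e -> (e <= l)%N.
Proof.
move=> dep e [P [Pprime Psub]]; rewrite leqNgt; apply/negP => lt_le.
have inord_lt i : (i <= l)%N -> ((inord i : 'I_e.+1) < (inord i.+1 : 'I_e.+1))%N.
  by move=> le_il; rewrite !inordK //; lia.
have step (i : 'I_l.+1) : exists x, x \notin P (inord i) /\ x \in P (inord i.+1).
  have [_ /existsNP[x]] := Psub _ _ (inord_lt i (leq_ord i)).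
  by move/not_implyP => [xP /negP xNP]; exists x.
have [f fP] := choice step.
have [Q Q0 Qf] := dep f.
have /negP[] : mmap c f Q \notin P (inord 0).
  apply: (@relation_in_chain _ _ c _ (fun i => P (inord i))) => // [i i_lt|i|i].
  - by have [] := Psub _ _ (inord_lt i i_lt).
  - by case: (fP i).
  - by case: (fP i).
by rewrite Qf; have [[]] := Pprime (inord 0).
Qed.

(** Primes of a quotient ring are obtained here as kernels of morphisms to
    domains; a morphism on the quotient is given by its values on
    representatives. *)
Lemma prime_ideal_quot (R : comNzRingType) (J : idealr R) (D : idomainType)
    (th : {rmorphism R -> D}) :
  (forall x, x \in J -> th x = 0) ->
  prime_ideal [pred x : {ideal_quot J} | th (repr x) == 0].
Proof.
move=> thJ.
have thE x y : x = y %[mod {ideal_quot J}] -> th x = th y.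
  move/eqP; rewrite -Quotient.idealrBE => /thJ.
  by rewrite rmorphB => /subr0_eq.
have thP x : th (repr (\pi_({ideal_quot J}) x)) = th x.
  by apply: thE; rewrite reprK.
split.
  split=> [||a u v]; rewrite !inE.
  - by rewrite -(rmorph0 \pi_({ideal_quot J})) thP rmorph0.
  - by rewrite -(rmorph1 \pi_({ideal_quot J})) thP rmorph1 oner_eq0.
  rewrite -[a]reprK -[u]reprK -[v]reprK -rmorphM -rmorphD !thP.
  by rewrite rmorphD rmorphM => /eqP -> /eqP ->; rewrite mulr0 addr0.
move=> u v; rewrite !inE -[u]reprK -[v]reprK -rmorphM !thP rmorphM.
by rewrite mulf_eq0.
Qed.

End KrullBounds.

(** * Algebraic dependence in polynomial rings *)

Section AlgebraicDependence.
Local Open Scope ring_scope.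

Lemma rmorph_mmap m (T : nzRingType) (R R' : comNzRingType)
    (c : {rmorphism T -> R})
    (f : 'I_m -> R) (h : {rmorphism R -> R'}) (Q : {mpoly T[m]}) :
  h (mmap c f Q) = mmap (h \o c) (h \o f) Q.
Proof.
rewrite /mmap rmorph_sum /=; apply: eq_bigr => u _.
rewrite rmorphM /mmap1 rmorph_prod; congr (_ * _).
by apply: eq_bigr => i _; rewrite rmorphXn.
Qed.

Variables (K : fieldType) (n l : nat).
Implicit Types (p q : {mpoly K[n]}) (u : 'X_{1..n}).

Definition small_support e p : Prop :=
  forall u, u \in msupp p ->
    (mdeg u <= e)%N /\ forall j : 'I_n, (l <= j)%N -> u j = 0%N.

Lemma small_support1 e : small_support e 1.
Proof.
by move=> u; rewrite msupp1 inE => /eqP ->; split=> [|j _]; rewrite ?mdeg0 ?mnm0E.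
Qed.

Lemma small_supportM e1 e2 p q : small_support e1 p -> small_support e2 q ->
  small_support (e1 + e2) (p * q).
Proof.
move=> sp sq u /msuppM_le/allpairsP => -[[a b] /= [/sp[da za] /sq[db zb] ->]].
by split=> [|j lj]; rewrite ?mdegD ?leq_add // mnmDE za ?zb.
Qed.

Lemma small_supportX e k p : small_support e p -> small_support (k * e) (p ^+ k).
Proof.
move=> sp; elim: k => [|k IHk]; first exact: small_support1.
by rewrite exprS mulSn; apply: small_supportM.
Qed.

Lemma small_support_prod e (I : finType) (F : I -> {mpoly K[n]}) :
  (forall i, small_support e (F i)) -> small_support (#|I| * e) (\prod_i F i).
Proof.
move=> sF; rewrite cardE -big_enum /=; elim: (enum I) => [|i s IHs].
  by rewrite big_nil; apply: small_support1.
by rewrite big_cons mulSn; apply: small_supportM.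
Qed.

(** A finite type of monomials in the first l variables, large enough to carry
    all the coefficients of the products under consideration. *)
Definition box_mnm e (b : {ffun 'I_l -> 'I_e.+1}) : 'X_{1..n} :=
  [multinom oapp (fun o => val (b o)) 0%N (insub (val j)) | j < n].

Lemma small_support_box e p u : small_support e p -> u \in msupp p ->
  exists b : {ffun 'I_l -> 'I_e.+1}, u = box_mnm b.
Proof.
move=> sp /sp[du zu].
exists [ffun o : 'I_l => inord (oapp u 0%N (insub (val o)))].
apply/mnmP => j; rewrite mnmE; case: insubP => [o jl oj|]; last first.
  by rewrite -leqNgt => /zu.
rewrite /= ffunE oj valK /= inordK // ltnS; apply: leq_trans du.
by rewrite mdegE (bigD1 j) //= leq_addr.
Qed.

(** Among the g_i there are (k+1)^(l+1) monomials with exponents at most k, and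
    their coefficients live in boxes of size (O(k))^l. For large k there are more
    of the former, so that the matrix of coefficients has a nontrivial left kernel,
    whose vectors are the coefficients of a relation. *)
Lemma mpoly_alg_dep (g : 'I_l.+1 -> {mpoly K[n]}) :
  (forall i u, u \in msupp (g i) -> forall j : 'I_n, (l <= j)%N -> u j = 0%N) ->
  exists2 Q : {mpoly K[l.+1]}, Q != 0 & mmap (@mpolyC n K) g Q = 0.
Proof.
move=> zg; pose D := \max_i msize (g i).
(* e + 1 <= (k + 1) C, so the box has at most (k + 1)^l C^l < (k + 1)^(l+1)
   elements. *)
pose C := (l.+1 * D).+1; pose k := (C ^ l)%N; pose e := (l.+1 * (k * D))%N.
pose F (a : {ffun 'I_l.+1 -> 'I_k.+1}) := \prod_i g i ^+ a i.
have sF a : small_support e (F a).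
  rewrite /e -[X in (X * _)%N]card_ord; apply: small_support_prod => i.
  have sg : small_support D (g i).
    move=> u ug; split; last exact: zg ug.
    by apply: leq_trans (leq_bigmax i); apply/ltnW/msize_mdeg_lt.
  move=> u /(small_supportX sg)[du zu]; split=> //.
  by apply: leq_trans du _; rewrite leq_mul2r leq_ord orbT.
pose M := \matrix_(a < #|{ffun 'I_l.+1 -> 'I_k.+1}|,
                   b < #|{ffun 'I_l -> 'I_e.+1}|)
            (F (enum_val a))@_(box_mnm (enum_val b)).
have : kermx M != 0.
  rewrite kermx_eq0 /row_free neq_ltn; apply/orP; left.
  apply: leq_ltn_trans (rank_leq_col M) _; rewrite !card_ffun !card_ord.
  apply: (@leq_ltn_trans ((k.+1 * C) ^ l)%N).
    have [->|l0] := posnP l; first by rewrite !expn0.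
    by rewrite leq_exp2r //; rewrite /e /C; nia.
  by rewrite expnMn expnS mulnC ltn_pmul2r ?expn_gt0 // -/k.
case/rowV0Pn => v /sub_kermxP vM /rV0Pn[a0 va0].
pose X (a : 'I_#|{ffun 'I_l.+1 -> 'I_k.+1}|) : 'X_{1..l.+1} :=
  [multinom val (enum_val a i) | i < l.+1].
have Xinj : injective X.
  move=> a b /mnmP E; apply: enum_val_inj; apply/ffunP => i; apply: val_inj.
  by have := E i; rewrite !mnmE.
exists (\sum_a v 0 a *: 'X_[X a]).
  apply: contraNneq va0 => /mpolyP/(_ (X a0)); rewrite mcoeff0 raddf_sum /=.
  rewrite (bigD1 a0) //= big1 ?addr0 => [|a aN]; rewrite mcoeffZ mcoeffX.
    by rewrite eqxx mulr1 => ->.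
  by rewrite (inj_eq Xinj) (negPf aN) mulr0.
rewrite [LHS](raddf_sum (mmap (@mpolyC n K) g)); apply/mpolyP => u.
rewrite [RHS](mcoeff0 K u) raddf_sum /=.
have XE a : (mmap (@mpolyC n K) g (v 0 a *: 'X_[X a]))@_u
            = v 0 a * (F (enum_val a))@_u.
  rewrite mmapZ mmapX mcoeffCM /mmap1 /F; congr (_ * (_)@_u).
  by apply: eq_bigr => i _; rewrite mnmE.
under eq_bigr do rewrite XE.
have [[b ub]|Nb] := pselect (exists b : {ffun 'I_l -> 'I_e.+1}, u = box_mnm b).
  move/matrixP: vM => /(_ 0 (enum_rank b)); rewrite !mxE => vM.
  by rewrite -[RHS]vM; apply: eq_bigr => a _; rewrite mxE enum_rankK ub.
apply: big1 => a _; rewrite memN_msupp_eq0 ?mulr0 //.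
by apply/negP => /(small_support_box (sF _)).
Qed.

End AlgebraicDependence.

(** * Powers and minimal generators of monomial ideals *)

Section PowersOfMonomialIdeals.
Local Open Scope classical_set_scope.
Variables (K : fieldType) (n : nat).
Implicit Types (A B : set 'X_{1..n}) (u v a b : 'X_{1..n}).
Local Notation mon_ideal := (@mon_ideal K n).

Definition msumset A B : set 'X_{1..n} := [set (a + b)%MM | a in A & b in B].

Definition mpowset A k : set 'X_{1..n} := iter k (msumset A) [set 0%MM].

Lemma mon_idealS A I :
  is_ideal I -> (forall a, A a -> I 'X_[a]) -> mon_ideal A `<=` I.
Proof. by move=> I_ AI; apply: smallest_sub => // _ [a Aa <-]; apply: AI. Qed.

Lemma lepm_add u v a b : (u <= v)%MM -> (a <= b)%MM -> (u + a <= v + b)%MM.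
Proof.
move=> /mnm_lepP uv /mnm_lepP ab; apply/mnm_lepP => j.
by rewrite !mnmDE leq_add.
Qed.

Lemma mon_ideal_mul A B :
  ideal_mul (mon_ideal A) (mon_ideal B) = mon_ideal (msumset A B).
Proof.
apply/seteqP; split.
  apply: ideal_mul_sub => [|p q /mon_idealP Ap /mon_idealP Bq].
    exact: ideal_genP.
  apply/mon_idealP => u /msuppM_le/allpairsP.
  move=> [[v w] /= [/Ap[a Aa av] /Bq[b Bb bw] ->]].
  by exists (a + b)%MM; [exists a => //; exists b|exact: lepm_add].
apply: mon_idealS => [|_ [a Aa] [b Bb <-]]; first exact: ideal_mulP.
by rewrite mpolyXD; apply: ideal_mul_mem; apply/mon_idealX;
  [exists a|exists b]; rewrite ?lepm_refl.
Qed.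

Lemma mon_ideal_pow A k : ideal_pow (mon_ideal A) k = mon_ideal (mpowset A k).
Proof.
elim: k => [|k IHk]; last first.
  by rewrite /ideal_pow iterS -/(ideal_pow _ k) IHk mon_ideal_mul.
apply/seteqP; split=> // p _; apply/mon_idealP => u _.
by exists 0%MM => //; apply/mnm_lepP => j; rewrite mnm0E.
Qed.

Lemma mpowset2 A : mpowset A 2 = msumset A A.
Proof.
rewrite /mpowset /=; congr msumset; apply/seteqP; split=> u.
  by move=> [a Aa] [_ -> <-]; rewrite addm0.
by move=> Au; exists u => //; exists 0%MM => //; rewrite addm0.
Qed.

Lemma mpowset_deg d A k : (forall a, A a -> mdeg a = d) ->
  forall u, mpowset A k u -> mdeg u = (d * k)%N.
Proof.
move=> dA; elim: k => [|k IHk] u; first by move=> ->; rewrite mdeg0 muln0.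
by move=> [a Aa] [b Bb <-]; rewrite mdegD dA // IHk // mulnS.
Qed.

Lemma mpowset_zero A k j : (forall a, A a -> a j = 0%N) ->
  forall u, mpowset A k u -> u j = 0%N.
Proof.
move=> zA; elim: k => [|k IHk] u; first by move=> ->; rewrite mnm0E.
by move=> [a Aa] [b Bb <-]; rewrite mnmDE zA // IHk.
Qed.

Lemma lepm_mdeg u v : (u <= v)%MM -> mdeg v = mdeg u -> v = u.
Proof.
move=> uv; rewrite -(submK uv) mdegD => /eqP; rewrite -[X in _ == X]add0n eqn_add2r.
by rewrite mdeg_eq0 => /eqP ->; rewrite add0m.
Qed.

Lemma lepm_mdegW u v : (u <= v)%MM -> (mdeg u <= mdeg v)%N.
Proof. by move=> uv; rewrite -(submK uv) mdegD leq_addl. Qed.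

Lemma mingens_equigen d A : (forall a, A a -> mdeg a = d) ->
  mingens (mon_ideal A) = A.
Proof.
move=> dA; rewrite mingensE; last by exists A.
apply/seteqP; split=> [|u Au]; first exact: minmons_sub.
split=> [|v /mon_idealX[a Aa av] vu].
  by apply/mon_idealX; exists u; rewrite ?lepm_refl.
apply/esym/lepm_mdeg => //; apply/eqP; rewrite eqn_leq.
by rewrite (lepm_mdegW vu) andbT (dA _ Au) -(dA _ Aa) lepm_mdegW.
Qed.

Lemma mon_ideal_maxid_mul A :
  ideal_mul (@maxid K n) (mon_ideal A) =
  mon_ideal (msumset [set U_(i)%MM | i in [set: 'I_n]] A).
Proof.
rewrite -mon_ideal_mul; congr (ideal_mul (ideal_gen _) _).
by rewrite image_comp.
Qed.

(** An element of an ideal generated in degree d has all its monomials in degree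
    at least d, and those of degree d are generators up to scalars: multiplying by
    the maximal ideal removes exactly these. *)
Lemma fiber_mem_equigen d A (p : {mpoly K[n]}) :
  (forall a, A a -> mdeg a = d) -> mon_ideal A p ->
  ideal_mul (@maxid K n) (mon_ideal A) p <->
  forall u, u \in msupp p -> mdeg u <> d.
Proof.
move=> dA /mon_idealP Ap; rewrite mon_ideal_maxid_mul; split.
  move=> /mon_idealP mp u /mp[_ [_ [i _ <-]] [a Aa <-]] /lepm_mdegW.
  by rewrite mdegD mdeg1 (dA a Aa) => + du; rewrite du ltnn.
move=> dp; apply/mon_idealP => u up; have [a Aa au] := Ap u up.
have /eqP : (u - a)%MM <> 0%MM.
  by move=> ua0; apply: (dp u up); rewrite -(submK au) ua0 add0m dA.
rewrite -mdeg_eq0 => ua; have /existsP[i ui] : [exists i, (u - a)%MM i != 0%N].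
  apply: contraNT ua => /existsPn u0; rewrite mdegE big1 // => i _.
  by apply/eqP; rewrite -[_ == _]negbK u0.
exists (U_(i) + a)%MM; first by exists U_(i)%MM; [exists i|exists a].
rewrite -(submK au); apply: lepm_add; rewrite ?lepm_refl //.
by apply/mnm_lepP => j; rewrite mnm1E; case: eqVneq => // <-; rewrite lt0n.
Qed.

End PowersOfMonomialIdeals.

(** * Homogeneous components and elimination of variables *)

Section Pieces.
Local Open Scope ring_scope.
Variables (K : fieldType) (n : nat).
Local Notation S := {mpoly K[n]}.
Implicit Types (p q : S) (u : 'X_{1..n}).

Lemma mcoeff_pihomog e p u :
  (pihomog mdeg e p)@_u = if mdeg u == e then p@_u else 0.
Proof.
rewrite pihomogE raddf_sum /=.
under eq_bigr do rewrite mcoeffZ mcoeffX.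
have [up|up] := boolP (u \in msupp p); last first.
  rewrite (memN_msupp_eq0 up) if_same big_seq_cond big1 // => v /andP[vp _].
  by case: eqVneq vp => [->|]; rewrite ?(negPf up) ?mulr0.
rewrite big_mkcond (bigD1_seq u) ?msupp_uniq //= eqxx mulr1 big1 ?addr0 // => v vu.
by rewrite (negPf vu) mulr0 if_same.
Qed.

Definition order_ge e p : Prop := forall u, u \in msupp p -> (e <= mdeg u)%N.

Lemma order_geM a b p q : order_ge a p -> order_ge b q -> order_ge (a + b) (p * q).
Proof.
move=> ap bq u /msuppM_le/allpairsP[[v w] /= [/ap av /bq bw ->]].
by rewrite mdegD leq_add.
Qed.

Lemma pihomog_order_gt e p : order_ge e.+1 p -> pihomog mdeg e p = 0.
Proof.
move=> ep; apply/mpolyP => u; rewrite mcoeff_pihomog mcoeff0.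
case: eqP => // ue; apply: memN_msupp_eq0; apply/negP => /ep.
by rewrite ue ltnn.
Qed.

Lemma order_gt_pihomog e p :
  order_ge e p -> order_ge e.+1 (p - pihomog mdeg e p).
Proof.
move=> ep u; rewrite mcoeff_msupp mcoeffB mcoeff_pihomog ltn_neqAle [e == _]eq_sym.
case: (eqVneq (mdeg u) e) => [_|ue]; rewrite ?subrr ?eqxx // subr0 -mcoeff_msupp.
by move/ep ->.
Qed.

Lemma order_ge_pihomog e p : order_ge e (pihomog mdeg e p).
Proof.
move=> u; rewrite mcoeff_msupp mcoeff_pihomog.
by case: (eqVneq (mdeg u) e) => [->|]; rewrite ?eqxx.
Qed.

(** Lowest terms are multiplicative: all the other products have larger degree. *)
Lemma pihomogM a b p q : order_ge a p -> order_ge b q ->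
  pihomog mdeg (a + b) (p * q) = pihomog mdeg a p * pihomog mdeg b q.
Proof.
move=> ap bq; set p0 := pihomog mdeg a p; set q0 := pihomog mdeg b q.
have -> : p * q = p0 * q0 + (p0 * (q - q0) + (p - p0) * q).
  by rewrite mulrBr mulrBl addrA [p0 * q0 + _]addrC subrK addrC subrK.
rewrite 2!raddfD /= [X in _ + (X + _)]pihomog_order_gt; last first.
  rewrite -addnS; apply: order_geM; first exact: order_ge_pihomog.
  exact: order_gt_pihomog.
rewrite [X in _ + (_ + X)]pihomog_order_gt; last first.
  by rewrite -addSn; apply: order_geM => //; apply: order_gt_pihomog.
rewrite !addr0 pihomog_dE //; apply: dhomogM; exact: pihomogP.
Qed.

Definition vars_lt j u : bool := [forall i : 'I_n, (j <= i)%N ==> (u i == 0%N)].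

Lemma vars_ltP j u :
  reflect (forall i : 'I_n, (j <= i)%N -> u i = 0%N) (vars_lt j u).
Proof.
by apply: (iffP 'forall_implyP) => u0 i ji; apply/eqP; apply: u0.
Qed.

Definition kill_vars j : S -> S :=
  mmap (@mpolyC n K) (fun i => if (i < j)%N then 'X_i else 0).

HB.instance Definition _ j := GRing.RMorphism.on (kill_vars j).

Lemma kill_varsX j u : kill_vars j 'X_[u] = if vars_lt j u then 'X_[u] else 0.
Proof.
rewrite /kill_vars mmapX /mmap1; case: ifPn => [/vars_ltP u0|].
  rewrite [RHS]mpolyXE_id; apply: eq_bigr => i _; case: ltnP => // /u0 ->.
  by rewrite !expr0.
rewrite negb_forall => /existsP[i]; rewrite negb_imply => /andP[ji ui].
by rewrite (bigD1 i) //= ltnNge ji /= expr0n (negPf ui) mul0r.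
Qed.

Lemma mcoeff_kill_vars j p u :
  (kill_vars j p)@_u = if vars_lt j u then p@_u else 0.
Proof.
rewrite [p in LHS]mpolyE [in LHS](raddf_sum (kill_vars j)) raddf_sum /=.
rewrite [p in RHS]mpolyE raddf_sum /=.
have E v : (kill_vars j (p@_v *: 'X_[v]))@_u
    = if vars_lt j u then (p@_v *: 'X_[v])@_u else 0.
  rewrite /kill_vars mmapZ mcoeffCM -/(kill_vars j _) kill_varsX mcoeffZ.
  have [->|uv] := eqVneq v u; first by case: ifP; rewrite ?mcoeff0 ?mulr0.
  rewrite mcoeffX (negPf uv).
  by case: ifP; rewrite ?mcoeffX ?(negPf uv) ?mcoeff0 mulr0 if_same.
under eq_bigr do rewrite E.
by case: ifP => // _; rewrite big1.
Qed.

Lemma kill_vars_leq j k p : (k <= j)%N -> kill_vars j p = 0 -> kill_vars k p = 0.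
Proof.
move=> kj /mpolyP p0; apply/mpolyP => u; have := p0 u.
rewrite !mcoeff_kill_vars mcoeff0.
case: ifP => [_ ->|uj _]; first by rewrite if_same.
case: ifP => // /vars_ltP uk; case/negP: uj; apply/vars_ltP => i ji.
by apply: uk; apply: leq_trans ji.
Qed.

End Pieces.

(** * The fiber ring of an equigenerated monomial ideal *)

Section FiberRing.
Local Open Scope classical_set_scope.
Local Open Scope quotient_scope.
Local Open Scope ring_scope.
Variables (K : fieldType) (n d : nat) (A : set 'X_{1..n}).
Hypothesis d_gt0 : (0 < d)%N.
Hypothesis degA : forall a, A a -> mdeg a = d.
Local Notation S := {mpoly K[n]}.
Local Notation I := (@mon_ideal K n A).

(** As I^k lives in degrees at least dk, this keeps the lowest possible component
    of each coefficient. *)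
Definition fiber_map (x : rees I) : S :=
  \sum_(k < size (rees_val x)) pihomog mdeg (d * k) (rees_val x)`_k.

Lemma rees_monomial (x : rees I) k u :
  u \in msupp (rees_val x)`_k -> exists2 a, mpowset A k a & (a <= u)%MM.
Proof. by have := rees_coef x k; rewrite mon_ideal_pow => /mon_idealP; apply. Qed.

Lemma rees_order (x : rees I) k : order_ge (d * k) (rees_val x)`_k.
Proof.
by move=> u /rees_monomial[a /(mpowset_deg degA) <- /lepm_mdegW].
Qed.

Lemma mcoeff_fiber_map x k u : mdeg u = (d * k)%N ->
  (fiber_map x)@_u = ((rees_val x)`_k)@_u.
Proof.
move=> uk; rewrite raddf_sum /=.
under eq_bigr do rewrite mcoeff_pihomog uk eqn_pmul2l //.
have [k_lt|k_ge] := ltnP k (size (rees_val x)).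
  rewrite (bigD1 (Ordinal k_lt)) //= eqxx big1 ?addr0 // => i.
  by rewrite -val_eqE eq_sym => /negPf /= ->.
rewrite [in RHS]nth_default // mcoeff0 big1 // => i _.
by case: eqP => // ki; have := ltn_ord i; rewrite -ki ltnNge k_ge.
Qed.

Lemma mcoeff_fiber_map0 x u : ~~ (d %| mdeg u)%N -> (fiber_map x)@_u = 0.
Proof.
move=> du; rewrite raddf_sum /= big1 // => i _; rewrite mcoeff_pihomog.
by case: eqP => // ui; rewrite ui dvdn_mulr in du.
Qed.

Lemma fiber_mapE m (x : rees I) : (size (rees_val x) <= m)%N ->
  fiber_map x = \sum_(k < m) pihomog mdeg (d * k) (rees_val x)`_k.
Proof.
move=> xm; rewrite /fiber_map (big_ord_widen m (fun k =>
  pihomog mdeg (d * k) (rees_val x)`_k)) // big_mkcond; apply: eq_bigr => k _.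
by case: ltnP => // /(nth_default 0) ->; rewrite raddf0.
Qed.

Lemma fiber_map_is_zmod_morphism : zmod_morphism fiber_map.
Proof.
move=> x y; pose m := maxn (size (rees_val x)) (size (rees_val y)).
rewrite (fiber_mapE (leq_maxl _ _ : _ <= m)%N).
rewrite (fiber_mapE (leq_maxr _ _ : _ <= m)%N) -sumrB (@fiber_mapE m).
  by apply: eq_bigr => k _; rewrite coefB raddfB.
by rewrite (leq_trans (size_polyD _ _)) // size_polyN.
Qed.

(** Multiplicativity is read off coefficientwise before the variable of the Rees
    algebra is set to 1. *)
Lemma fiber_map_poly (x : rees I) : fiber_map x =
  (\poly_(k < size (rees_val x)) pihomog mdeg (d * k) (rees_val x)`_k).[1].
Proof. by rewrite horner_poly; apply: eq_bigr => k _; rewrite expr1n mulr1. Qed.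

Lemma fiber_map_is_monoid_morphism : monoid_morphism fiber_map.
Proof.
split=> [|x y].
  rewrite (@fiber_mapE 1%N) ?size_polyC ?leq_b1 // big_ord1 /= coef1 /=.
  by rewrite muln0 pihomog_dE // dhomog1.
rewrite !fiber_map_poly -hornerM; congr _.[1]; apply/polyP => k.
have E (z : rees I) i : (\poly_(k < size (rees_val z))
    pihomog mdeg (d * k) (rees_val z)`_k)`_i = pihomog mdeg (d * i) (rees_val z)`_i.
  by rewrite coef_poly; case: ltnP => // /(nth_default 0) ->; rewrite raddf0.
rewrite E !coefM raddf_sum /=; apply: eq_bigr => i _; rewrite !E.
have {1}<- : (d * i + d * (k - i))%N = (d * k)%N.
  by rewrite -mulnDr subnKC // leq_ord.
by apply: pihomogM; apply: rees_order.
Qed.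

HB.instance Definition _ :=
  GRing.isZmodMorphism.Build (rees I) S fiber_map fiber_map_is_zmod_morphism.
HB.instance Definition _ :=
  GRing.isMonoidMorphism.Build (rees I) S fiber_map fiber_map_is_monoid_morphism.

(** The coefficient of t^k contributes in degree dk only, and d > 0 separates the
    contributions of different k; so the kernel consists of the elements without
    monomials of degree dk at t^k, and that is m I^k. *)
Lemma fiber_map_eq0 x : (fiber_map x = 0) <-> x \in fiber_ideal I.
Proof.
have mem k : ideal_mul (@maxid K n) (ideal_pow I k) (rees_val x)`_k <->
    forall u, u \in msupp (rees_val x)`_k -> mdeg u <> (d * k)%N.
  have := rees_coef x k; rewrite mon_ideal_pow => xk.
  by apply: fiber_mem_equigen xk; apply: mpowset_deg.
split=> [x0|/fiber_idealP xJ].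
  apply/fiber_idealP => k; apply/mem => u + uk.
  by rewrite mcoeff_msupp -mcoeff_fiber_map // x0 mcoeff0 eqxx.
apply/mpolyP => u; rewrite mcoeff0.
have [/dvdnP[k uk]|/mcoeff_fiber_map0 //] := boolP (d %| mdeg u)%N.
rewrite mulnC in uk; rewrite (mcoeff_fiber_map x uk); apply: memN_msupp_eq0.
by apply/negP => /((mem k).1 (xJ k)).
Qed.

Lemma msupp_fiber_map x u : u \in msupp (fiber_map x) -> exists k, mpowset A k u.
Proof.
rewrite mcoeff_msupp.
have [/dvdnP[k uk]|/mcoeff_fiber_map0 ->] := boolP (d %| mdeg u)%N; last first.
  by rewrite eqxx.
rewrite mulnC in uk; rewrite (mcoeff_fiber_map x uk) -mcoeff_msupp.
move=> /rees_monomial[a Aa au]; exists k.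
by rewrite (lepm_mdeg au) // uk (mpowset_deg degA Aa).
Qed.

Lemma rees_const_subproof (c : K) : c%:MP%:P \in rees_pred I.
Proof.
apply/rees_predP => -[|k] //; rewrite coefC /=.
by have [] := ideal_powP I k.+1.
Qed.

Definition rees_const (c : K) : rees I := Rees (rees_const_subproof c).

Lemma rees_const_is_zmod_morphism : zmod_morphism rees_const.
Proof. by move=> a b; apply: val_inj; rewrite /= mpolyCB polyCB. Qed.

Lemma rees_const_is_monoid_morphism : monoid_morphism rees_const.
Proof. by split=> [|a b]; apply: val_inj; rewrite /= ?mpolyCM ?polyCM. Qed.

HB.instance Definition _ :=
  GRing.isZmodMorphism.Build K (rees I) rees_const rees_const_is_zmod_morphism.
HB.instance Definition _ :=
  GRing.isMonoidMorphism.Build K (rees I) rees_const rees_const_is_monoid_morphism.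

Lemma fiber_map_const c : fiber_map (rees_const c) = c%:MP.
Proof.
rewrite (@fiber_mapE 1%N) ?size_polyC ?leq_b1 // big_ord1 /= coefC /=.
rewrite muln0 pihomog_dE //; apply/dhomogP => u.
by rewrite msuppC; case: ifP => // _; rewrite inE => /eqP ->; apply: mdeg0.
Qed.

Lemma rees_gen_subproof a (Aa : A a) : ('X_[K, a])%:P * 'X \in rees_pred I.
Proof.
apply/rees_predP => k; rewrite coefMX coefC.
case: k => [|[|k]] //=; last by have [] := ideal_powP I k.+2.
suff : ideal_pow I 1 'X_[a] by [].
rewrite mon_ideal_pow; apply/mon_idealX; exists a; rewrite ?lepm_refl //.
by exists a => //; exists 0%MM; rewrite // addm0.
Qed.

Definition rees_gen a (Aa : A a) : rees I := Rees (rees_gen_subproof Aa).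

Lemma fiber_map_gen a (Aa : A a) : fiber_map (rees_gen Aa) = 'X_[a].
Proof.
rewrite (@fiber_mapE 2%N) /=; last first.
  apply: leq_trans (size_polyMleq _ _) _.
  by rewrite size_polyX addn2 /= ltnS size_polyC_leq1.
rewrite big_ord_recl big_ord1 !coefMX /= raddf0 add0r coefC /= muln1.
by rewrite pihomog_dE // dhomogX /= degA.
Qed.

Variable l : nat.
Hypothesis A_vars : forall a, A a -> forall i : 'I_n, (l <= i)%N -> a i = 0%N.
Hypothesis A_last : forall j, (j < l)%N -> exists2 a, A a &
  ~~ vars_lt j a /\ vars_lt j.+1 a.

(** In degree dk the elements of I^k only involve products of k generators, hence
    only the first l variables, and a relation between their images lifts to
    the fiber ring since the kernel of [fiber_map] is the fiber ideal. *)
Lemma fiber_ring_dep (f : 'I_l.+1 -> fiber_ring I) :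
  exists2 Q : {mpoly K[l.+1]}, Q != 0 &
    mmap (\pi_(fiber_ring I) \o rees_const) f Q = 0.
Proof.
have [|Q Q0 Qf] := @mpoly_alg_dep K n l (fun i => fiber_map (repr (f i))).
  move=> i u /(msupp_fiber_map)[k Aku] j lj.
  by apply: mpowset_zero Aku => a /A_vars; apply.
exists Q => //.
have -> : f = \pi_(fiber_ring I) \o (repr \o f).
  by apply/funext => i /=; rewrite reprK.
rewrite -rmorph_mmap -[RHS](rmorph0 \pi_(fiber_ring I)); apply/eqP.
rewrite -Quotient.idealrBE subr0; apply/fiber_map_eq0.
rewrite rmorph_mmap -[RHS]Qf; congr (mmap _ _ Q).
by apply/funext => c /=; rewrite fiber_map_const.
Qed.

(** The primes of the chain are the kernels of [kill_vars (l - i)] composed with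
    [fiber_map]. The generator whose last variable has index l - j separates the
    kernels for i < j: it survives only as long as that variable is kept. *)
Lemma analytic_spread_mon_ideal : analytic_spread I l.
Proof.
split; last exact: prime_chain_leq fiber_ring_dep.
pose th j : {rmorphism rees I -> S} := kill_vars j \o fiber_map.
have th_fiber j (x : rees I) : x \in fiber_ideal I -> th j x = 0.
  by move=> /fiber_map_eq0 x0; rewrite /= x0 rmorph0.
pose P (i : 'I_l.+1) : {pred fiber_ring I} :=
  [pred x : fiber_ring I | th (l - i)%N (repr x) == 0].
have PE i x : x \in P i <-> kill_vars (l - i) (fiber_map (repr x)) = 0.
  by split=> /eqP.
exists P.
split=> [i|i j lt_ij].
  exact: (@prime_ideal_quot _ (fiber_ideal I) _ (th _) (th_fiber (l - i)%N)).
split=> [x /PE xi|sub].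
  by apply/PE; apply: kill_vars_leq xi; rewrite leq_sub2l // ltnW.
have [|a Aa [aj aj1]] := @A_last (l - j)%N; first by have := ltn_ord j; lia.
have thE k : th k (repr (\pi_(fiber_ring I) (rees_gen Aa))) =
             if vars_lt k a then 'X_[a] else 0.
  rewrite -kill_varsX -(fiber_map_gen Aa); apply/eqP.
  rewrite -[X in _ == X]/(th k _) -subr_eq0 -rmorphB; apply/eqP/th_fiber.
  by rewrite Quotient.idealrBE reprK.
have zj : th (l - j)%N (repr (\pi_(fiber_ring I) (rees_gen Aa))) = 0.
  by have := thE (l - j)%N; rewrite (negPf aj).
have := (PE _ _).1 (sub _ ((PE _ _).2 zj)).
have /= -> := thE (l - i)%N.
case: ifPn => [_ /eqP|/negP Nv _]; first by rewrite -msupp_eq0 msuppX.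
case: Nv; apply/vars_ltP => k ki; move/vars_ltP: aj1; apply; apply: leq_trans ki.
by have := ltn_ord j; lia.
Qed.

End FiberRing.

(** * The Borel order *)

Section BorelOrder.
Local Open Scope classical_set_scope.
Variables (K : fieldType) (n : nat).
Implicit Types (u v a : 'X_{1..n}).

Definition tail u t : nat := \sum_(j < n | t <= j) u j.

Lemma tail0 u : tail u 0 = mdeg u. Proof. by rewrite mdegE. Qed.

Lemma tailD u v t : tail (u + v)%MM t = tail u t + tail v t.
Proof. by rewrite /tail -big_split; apply: eq_bigr => j _; rewrite mnmDE. Qed.

Lemma tailU j t : tail U_(j)%MM t = (t <= j).
Proof.
rewrite /tail big_mkcond (bigD1 j) //= big1 ?mnm1E ?eqxx ?addn0; first by case: ifP.
by move=> i ij; rewrite mnm1E eq_sym (negPf ij) if_same.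
Qed.

Lemma tailS u (s : 'I_n) : tail u s = u s + tail u s.+1.
Proof.
rewrite /tail (bigD1 s) //=; congr (_ + _); apply: eq_bigl => j.
by rewrite -val_eqE /= ltn_neqAle eq_sym andbC.
Qed.

Definition borel_move u (i j : 'I_n) : 'X_{1..n} := (u - U_(j) + U_(i))%MM.

Lemma borel_moveE u i j : 0 < u j -> (borel_move u i j + U_(j) = u + U_(i))%MM.
Proof.
move=> uj; rewrite /borel_move -addmA [(U_(i) + _)%MM]addmC addmA submK //.
by apply/mnm_lepP => k; rewrite mnm1E; case: eqVneq => // <-.
Qed.

Lemma tail_move u i j t : 0 < u j ->
  tail (borel_move u i j) t + (t <= j) = tail u t + (t <= i).
Proof. by move=> /(borel_moveE i)/(congr1 (tail ^~ t)); rewrite !tailD !tailU. Qed.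

Lemma mdeg_move u i j : 0 < u j -> mdeg (borel_move u i j) = mdeg u.
Proof.
move=> uj; have := tail_move i 0 uj; rewrite !tail0.
by move/eqP; rewrite eqn_add2r => /eqP.
Qed.

(** If a is strictly below u, take the largest s at which their exponents
    differ. The tails agree beyond s, so u has the larger exponent at s, where
    s > 0 as the degrees agree. Moving one factor x_s of u to x_(s-1) only
    decreases the tail at s, by 1: the result is still above a. The sum of the
    indices of the factors of u decreases. *)
Lemma borel_descent I u a : borel I -> I 'X_[K, u] -> mdeg a = mdeg u ->
  (forall t, tail a t <= tail u t) -> I 'X_[K, a].
Proof.
move=> IB; pose wt (v : 'X_{1..n}) := \sum_(j < n) v j * j.
have [N] := ubnP (wt u); elim: N u => // N IHN u; rewrite ltnS => uN Iu dau au.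
have [->//|neq] := eqVneq a u.
have /existsP[s0 s0P] : [exists s, a s != u s].
  apply: contraNT neq => /existsPn au_eq; apply/eqP/mnmP => s.
  by apply/eqP; rewrite -[_ == _]negbK au_eq.
case: (@arg_maxnP _ s0 (fun s => a s != u s) val s0P) => s sP smax.
have tailE : tail a s.+1 = tail u s.+1.
  apply: eq_bigr => j sj; apply/eqP; rewrite -[_ == _]negbK; apply/negP.
  by move/smax; rewrite /= leqNgt sj.
have lt_s : tail a s < tail u s.
  have := au s; rewrite !tailS tailE leq_add2r ltn_add2r ltn_neqAle sP.
  exact.
have us : 0 < u s.
  by move: lt_s; rewrite !tailS tailE ltn_add2r; apply: leq_ltn_trans.
have s_gt0 : 0 < s.
  by rewrite lt0n; apply/eqP => s0E; move: lt_s; rewrite s0E !tail0 dau ltnn.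
have lt_in : s.-1 < n by apply: leq_ltn_trans (leq_pred s) (ltn_ord s).
pose i := Ordinal lt_in.
have lt_is : i < s by rewrite /= prednK.
apply: (IHN (borel_move u i s)).
- have : wt (borel_move u i s) + s = wt u + i.
    have wtD v w : wt (v + w)%MM = wt v + wt w.
      by rewrite /wt -big_split; apply: eq_bigr => j _; rewrite mnmDE mulnDl.
    have wtU j : wt U_(j)%MM = j.
      rewrite /wt (bigD1 j) //= mnm1E eqxx mul1n big1 ?addn0 // => k kj.
      by rewrite mnm1E eq_sym (negPf kj).
    by have := congr1 wt (borel_moveE i us); rewrite !wtD !wtU.
  by rewrite -[_ < N](ltn_add2r s) => ->; rewrite -addnS leq_add.
- by have [_] := (borelP I).1 IB; apply.
- by rewrite mdeg_move.
- move=> t; have := tail_move i t us; have := au t.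
  have [->|ts] := eqVneq t s; first by rewrite leqnn; move: lt_s lt_is; lia.
  have -> : (t <= i) = (t <= s) by move: ts; rewrite /=; lia.
  lia.
Qed.

(** Borel moves decrease tails, so what lies below the generators is stable under
    them; [borel_descent] gives minimality. *)
Lemma borel_hull_equigen d (U : set 'X_{1..n}) :
  (forall u, U u -> mdeg u = d) ->
  borel_hull K U = @mon_ideal K n
    [set a | mdeg a = d /\ exists2 u, U u & forall t, tail a t <= tail u t].
Proof.
move=> dU; set A := [set a | _].
have dA a : A a -> mdeg a = d by case.
apply/esym/borel_hullP; split.
- split=> [|u]; first by exists A.
  rewrite (mingens_equigen K dA) => -[du [v Uv uv]] i j uj ij.
  apply/mon_idealX; exists (borel_move u i j); last exact: lepm_refl.
  split; first by rewrite mdeg_move.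
  exists v => // t; have := tail_move i t uj; have := uv t.
  have : (t <= i) <= (t <= j).
    by case: (leqP t i) => // ti; rewrite (leq_trans ti (ltnW ij)).
  lia.
- move=> u Uu; apply/mon_idealX; exists u; last exact: lepm_refl.
  by split; [exact: dU|exists u].
- move=> J JB UJ; apply: mon_idealS => [|a [da [u Uu au]]].
    by have [[]] := (monomial_idealP J).1 JB.1.
  by apply: borel_descent JB (UJ u Uu) _ au; rewrite da dU.
Qed.

End BorelOrder.

(** * Staircase monomials *)

Lemma card_fset_range (T : finType) (V : choiceType) (f : T -> V) :
  injective f -> #|` fset_set (range f)| = #|T|.
Proof.
move=> finj; rewrite fset_set_image; last exact: finite_finset.
rewrite card_imfset //= cardE.
apply/perm_size/uniq_perm; rewrite ?fset_uniq ?enum_uniq //.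
by move=> x; rewrite in_fset_set ?mem_enum ?in_setT //; exact: finite_finset.
Qed.

Lemma card_sum_ord_sig (L : nat) (F : nat -> nat) (T : 'I_L -> finType) :
  (forall s : 'I_L, #|T s| = F s) -> #|{: {s : 'I_L & T s}}| = \sum_(s < L) F s.
Proof.
by move=> TF; rewrite card_tagged sumnE big_map big_enum /=; apply: eq_bigr.
Qed.

(** By induction on L: the row t = L adds (w_0 + ... + w_(L-1)) + (L + 2) w_L
    - (L + 1), and C(L + 2, 2) - C(L + 1, 2) = L + 1. *)
Lemma sum_triangle (w : nat -> nat) L : (forall s, s < L -> 0 < w s) ->
  \sum_(t < L) \sum_(s < t.+1) (w s + w t - 1) + 'C(L.+1, 2) =
  L.+1 * \sum_(s < L) w s.
Proof.
elim: L => [|L IHL] w_gt0; first by rewrite !big_ord0.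
have row : \sum_(s < L.+1) (w s + w L - 1) + L.+1 =
           \sum_(s < L.+1) w s + L.+1 * w L.
  have sumc c : \sum_(s < L.+1) c = L.+1 * c by rewrite sum_nat_const card_ord.
  rewrite -[X in _ + X = _]muln1 -!sumc -!big_split.
  by apply: eq_bigr => s _ /=; have := w_gt0 s (ltn_ord s); lia.
have := IHL (fun s sL => w_gt0 s (ltnW sL)).
move: row; rewrite ['C(L.+2, 2)]binS bin1 !big_ord_recr /=.
set a := \sum_(i < L) _; set b := \sum_(t < L) _; set c := \sum_(i < L) _.
move: a b c 'C(L.+1, 2) (w L) => a b c e x row IH.
have -> : c + (a + (x + x - 1)) + (e + L.+1) = (c + e) + (a + (x + x - 1) + L.+1).
  by rewrite addnACA !addnA.
rewrite row IH [L.+2 * _]mulSn mulnDr.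
by rewrite addnCA !addnA.
Qed.

Section Staircase.
Local Open Scope classical_set_scope.
Variables (K : fieldType) (n : nat).
Implicit Types (u v a : 'X_{1..n}).

Lemma xvarE i (j : 'I_n) : xvar n i j = (j.+1 == i).
Proof. by rewrite mnmE. Qed.

Lemma tail_inj u v : tail u =1 tail v -> u = v.
Proof.
move=> uv; apply/mnmP => j; have := uv j.
by rewrite !tailS uv => /eqP; rewrite eqn_add2r => /eqP.
Qed.

Lemma tailMn u k t : tail (u *+ k)%MM t = tail u t * k.
Proof. by rewrite /tail big_distrl; apply: eq_bigr => j _; rewrite mulmnE. Qed.

Lemma tail_xvar i t : i <= n -> tail (xvar n i) t = (t < i).
Proof.
move=> i_n; rewrite /tail; under eq_bigr do rewrite xvarE.
case: i i_n => [|i] i_n; first by rewrite big1.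
rewrite big_mkcond (bigD1 (Ordinal i_n)) //= eqxx big1 ?addn0 => [|j].
  by rewrite ltnS; case: leqP.
by rewrite -val_eqE eqSS => /negPf /= ->; rewrite if_same.
Qed.

(** The factor y_s, which is 1 for s = 0 and x_(s+2) otherwise. With the variables
    numbered from 1, [xvar n 0] is the monomial 1, which gives y_0. *)
Definition yvar s : 'X_{1..n} := xvar n (if 0 < s then s.+2 else 0).

(** The monomial x_2^b y_s y_t, filled up by x_1 to degree D. *)
Definition stair D s t b : 'X_{1..n} :=
  (xvar n 1 *+ (D - b - (0 < s) - (0 < t)) + xvar n 2 *+ b + yvar s + yvar t)%MM.

Lemma stairE D s t b (j : 'I_n) : stair D s t b j =
  (j == 0 :> nat) * (D - b - (0 < s) - (0 < t)) + (j == 1 :> nat) * b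
  + ((0 < s) && (j == s.+1 :> nat)) + ((0 < t) && (j == t.+1 :> nat)).
Proof.
rewrite /stair !mnmDE !mulmnE /yvar !xvarE !eqSS.
by case: (0 < s); case: (0 < t); rewrite ?eqSS.
Qed.

Lemma tail_stair D s t b k : 1 < n -> s.+1 < n -> t.+1 < n ->
  tail (stair D s t b) k = (k < 1) * (D - b - (0 < s) - (0 < t)) + (k < 2) * b
  + ((0 < s) && (k < s.+2)) + ((0 < t) && (k < t.+2)).
Proof.
move=> n1 sn tn; rewrite /stair !tailD !tailMn /yvar !tail_xvar //; first last.
- exact: ltnW.
- by case: ifP.
- by case: ifP.
by case: (0 < s); case: (0 < t).
Qed.

Lemma mdeg_stair D s t b : 1 < n -> s.+1 < n -> t.+1 < n ->
  b + (0 < s) + (0 < t) <= D -> mdeg (stair D s t b) = D.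
Proof.
move=> n1 sn tn bD; rewrite -tail0 tail_stair //= !andbT !mul1n.
by move: (nat_of_bool (0 < s)) (nat_of_bool (0 < t)) bD => x y; lia.
Qed.

(** The exponents of x_3, ..., x_n recover t, the larger index, then s; the
    exponent of x_2 is b. *)
Lemma stair_inj D s t b s' t' b' :
  1 < n -> s <= t -> s' <= t' -> t.+1 < n -> t'.+1 < n ->
  stair D s t b = stair D s' t' b' -> [/\ s = s', t = t' & b = b'].
Proof.
move=> n1 st st' tn tn' /mnmP E.
have co j : 1 < j < n -> ((0 < s) && (j == s.+1)) + ((0 < t) && (j == t.+1)) =
    ((0 < s') && (j == s'.+1)) + ((0 < t') && (j == t'.+1)).
  move=> /andP[j1 jn]; have := E (Ordinal jn); rewrite !stairE /=.
  by case: j j1 jn => [|[|j]].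
have le_t x y x' y' : x <= y -> x' <= y' -> y.+1 < n ->
    (forall j, 1 < j < n -> ((0 < x) && (j == x.+1)) + ((0 < y) && (j == y.+1)) =
      ((0 < x') && (j == x'.+1)) + ((0 < y') && (j == y'.+1))) -> y <= y'.
  move=> xy xy' yn; case: (posnP y) => [->//|y0] /(_ y.+1).
  rewrite !ltnS y0 yn eqxx addn1 => /(_ isT) /esym.
  case: eqP => [[->]|_]; first by rewrite andbT.
  by rewrite andbF add0n; case: eqP => [[->]|]; rewrite ?andbF.
have tE : t = t'.
  apply/eqP; rewrite eqn_leq (le_t s t s' t') //.
  by rewrite (le_t s' t' s t) // => j jn; rewrite co.
subst t'.
have le_s x y : x.+1 < n ->
    (forall j, 1 < j < n -> (0 < x) && (j == x.+1) = (0 < y) && (j == y.+1)) ->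
    x <= y.
  move=> xn; case: (posnP x) => [->//|x0] /(_ x.+1).
  by rewrite !ltnS x0 xn eqxx => /(_ isT) /esym /andP[_ /eqP[->]].
have co' j : 1 < j < n -> (0 < s) && (j == s.+1) = (0 < s') && (j == s'.+1).
  by move=> /co /eqP; rewrite eqn_add2r => /eqP; do 2!case: (_ && _).
have sE : s = s'.
  have sn : s.+1 < n by apply: leq_ltn_trans tn.
  have sn' : s'.+1 < n by apply: leq_ltn_trans tn.
  apply/eqP; rewrite eqn_leq; apply/andP; split; first exact: le_s sn co'.
  by apply: (le_s s' s sn') => j jn; rewrite co'.
subst s'; split=> //.
have := E (Ordinal n1); rewrite !stairE /= !mul0n !mul1n !add0n => /eqP.
by rewrite !eqn_add2r => /eqP.
Qed.

End Staircase.

(** * Staircase ideals are Freiman *)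

Section StaircaseIdeal.
Local Open Scope classical_set_scope.
Variables (K : fieldType) (n d L : nat) (w : nat -> nat).
Hypothesis d_gt0 : 0 < d.
Hypothesis L_gt0 : 0 < L.
Hypothesis L_lt_n : L < n.
Hypothesis w_gt0 : forall s, s < L -> 0 < w s.
Hypothesis w0_gt1 : 1 < w 0.
Hypothesis w_le : forall s, s < L -> w s + (0 < s) <= d.+1.
Implicit Types (u v a : 'X_{1..n}).
Local Notation stair := (@stair n).

Definition stair_set : set 'X_{1..n} :=
  [set a | exists s b, [/\ s < L, b < w s & a = stair d 0 s b]].

Definition stair_set2 : set 'X_{1..n} :=
  [set a | exists t s b,
     [/\ t < L, s <= t, b < w s + w t - 1 & a = stair (2 * d) s t b]].

Let n_gt1 : 1 < n. Proof. exact: leq_ltn_trans L_gt0 L_lt_n. Qed.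

Let lt_n s : s < L -> s.+1 < n. Proof. by move=> sL; apply: leq_ltn_trans L_lt_n. Qed.

Lemma stair_set_deg a : stair_set a -> mdeg a = d.
Proof.
move=> [s [b [sL bw ->]]]; apply: mdeg_stair; rewrite ?lt_n //=.
by move: (0 < s) (w_le sL) bw => x; lia.
Qed.

Lemma stair_set2_deg a : stair_set2 a -> mdeg a = 2 * d.
Proof.
move=> [t [s [b [tL st bw ->]]]]; have sL := leq_ltn_trans st tL.
apply: mdeg_stair; rewrite ?lt_n //=; have := w_le sL; have := w_le tL.
have := w_gt0 sL; have := w_gt0 tL.
by move: (nat_of_bool (0 < s)) (nat_of_bool (0 < t)) (w s) (w t) bw => x y p q; lia.
Qed.

(** The bounds ensure that the truncated subtractions in the exponents of x_1 are
    genuine ones. *)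
Lemma stairD s t b c : b + (0 < s) <= d -> c + (0 < t) <= d ->
  (stair d 0 s b + stair d 0 t c)%MM = stair (2 * d) s t (b + c).
Proof.
move=> bs ct; apply/mnmP => j; rewrite mnmDE !stairE /= !addn0.
rewrite mulnDr !addnA.
have -> : 2 * d - (b + c) - (0 < s) - (0 < t) =
   (d - b - 0 - (0 < s)) + (d - c - 0 - (0 < t)).
  by move: (nat_of_bool (0 < s)) (nat_of_bool (0 < t)) bs ct => x y; lia.
rewrite mulnDr; lia.
Qed.

Lemma stairC D s t b : stair D s t b = stair D t s b.
Proof.
rewrite /stair -addmA [(yvar _ s + _)%MM]addmC addmA.
by rewrite [D - b - (0 < s) - _]subnAC.
Qed.

(** Each b < w_s + w_t - 1 splits as b1 + b2 with b1 < w_s and b2 < w_t: take b1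
    as large as possible. *)
Lemma msumset_stair : msumset stair_set stair_set = stair_set2.
Proof.
have bound s b : s < L -> b < w s -> b + (0 < s) <= d.
  by move=> sL; have := w_le sL; move: (nat_of_bool _) => x; lia.
have incl s b t c : s <= t -> t < L -> b < w s -> c < w t ->
    stair_set2 (stair (2 * d) s t (b + c)).
  by move=> st tL bw cw; exists t, s, (b + c); split=> //; lia.
apply/seteqP; split=> [_ [_ [s [b [sL bw ->]]]] [_ [t [c [tL cw ->]]] <-]|].
  rewrite stairD ?bound //; have [st|ts] := leqP s t; first exact: incl.
  by rewrite stairC addnC; apply: incl => //; apply: ltnW.
move=> _ [t [s [b [tL st bw ->]]]]; have sL := leq_ltn_trans st tL.
pose b1 := minn b (w s).-1; pose b2 := b - b1.
have b1w : b1 < w s by have := w_gt0 sL; rewrite /b1; lia.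
have b2w : b2 < w t by have := w_gt0 sL; have := w_gt0 tL; rewrite /b2 /b1; lia.
exists (stair d 0 s b1); first by exists s, b1.
exists (stair d 0 t b2); first by exists t, b2.
by rewrite stairD ?bound // subnKC // geq_minl.
Qed.

Lemma mu_stair : mu (@mon_ideal K n stair_set) = \sum_(s < L) w s.
Proof.
rewrite /mu (mingens_equigen _ stair_set_deg).
pose f (p : {s : 'I_L & 'I_(w s)}) := stair d 0 (tag p) (tagged p).
have -> : stair_set = range f.
  apply/seteqP; split=> [_ [s [b [sL bw ->]]]|_ [[s b] _ <-]].
    by exists (existT (fun s : 'I_L => 'I_(w s)) (Ordinal sL) (Ordinal bw)).
  by exists s, b; split.
rewrite card_fset_range => [|[s b] [s' b']].
  by apply: card_sum_ord_sig => s; rewrite card_ord.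
rewrite /f /= => /stair_inj[]; rewrite ?lt_n // => _ /val_inj ss'.
by case: _ / ss' b' => b' /val_inj ->.
Qed.

Lemma mu_stair2 : mu (@mon_ideal K n stair_set2) + 'C(L.+1, 2) =
  L.+1 * \sum_(s < L) w s.
Proof.
rewrite -sum_triangle // /mu (mingens_equigen _ stair_set2_deg); congr (_ + _).
pose T (t : 'I_L) := {s : 'I_t.+1 & 'I_(w s + w t - 1)}.
pose f (p : {t : 'I_L & T t}) :=
  stair (2 * d) (tag (tagged p)) (tag p) (tagged (tagged p)).
have -> : stair_set2 = range f.
  apply/seteqP; split=> [_ [t [s [b [tL st bw ->]]]]|_ [[t [s b]] _ <-]].
    pose q : T (Ordinal tL) := existT (fun s : 'I_t.+1 => 'I_(w s + w t - 1))
      (Ordinal (st : s < t.+1)) (Ordinal bw).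
    by exists (existT T (Ordinal tL) q).
  by exists t, s, b; split=> //; apply: leq_ord.
rewrite card_fset_range => [|[t [s b]] [t' [s' b']]].
  apply: (@card_sum_ord_sig _ (fun t => \sum_(s < t.+1) (w s + w t - 1))) => t.
  by apply: (@card_sum_ord_sig _ (fun s => w s + w t - 1)) => s; rewrite card_ord.
rewrite /f /= => /stair_inj[]; rewrite ?lt_n ?leq_ord // => ss' /val_inj tt'.
case: _ / tt' s' b' ss' => s' b' /val_inj ss'.
by case: _ / ss' b' => b' /val_inj ->.
Qed.

(** The generators x_1^d, x_1^(d-1) x_2 and x_1^(d-1) y_s have x_1, x_2 and
    y_s respectively as last variables; the second one exists as w_0 > 1. *)
Lemma analytic_spread_stair : analytic_spread (@mon_ideal K n stair_set) L.+1.
Proof.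
apply: (analytic_spread_mon_ideal K d_gt0 stair_set_deg).
  move=> _ [s [b [sL bw ->]]] i Li; rewrite stairE /=.
  have i1 : 1 < i by apply: leq_trans Li.
  have si : s.+1 < i by apply: leq_trans Li.
  by rewrite !gtn_eqF ?(ltnW i1) ?andbF.
have last a (j : 'I_n) : stair_set a -> a j != 0 ->
    (forall i : 'I_n, j < i -> a i = 0) ->
    exists2 a, stair_set a & ~~ vars_lt j a /\ vars_lt j.+1 a.
  move=> Aa aj a0; exists a => //; split; last exact/vars_ltP.
  by apply: contra aj => /vars_ltP ->.
have w0 := w_gt0 L_gt0.
case=> [|[|j]] jL.
- apply: (last (stair d 0 0 0) (Ordinal (ltnW n_gt1))); first by exists 0, 0.
    by rewrite stairE /= mul1n !subn0 !addn0 -lt0n.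
  by move=> i i0; rewrite stairE /= gtn_eqF // muln0.
- apply: (last (stair d 0 0 1) (Ordinal n_gt1)); first by exists 0, 1.
    by rewrite stairE.
  by move=> i i1; rewrite stairE /= !gtn_eqF // (ltn_trans _ i1).
- have lt_jn : j.+2 < n by apply: leq_trans jL L_lt_n.
  apply: (last (stair d 0 j.+1 0) (Ordinal lt_jn)).
  + by exists j.+1, 0; split=> //; apply: w_gt0.
  + by rewrite stairE /= eqxx.
  + by move=> i ij; rewrite stairE /= !gtn_eqF // (ltn_trans _ ij).
Qed.

Theorem freiman_stair : freiman (@mon_ideal K n stair_set).
Proof.
split; first by exists stair_set.
  by exists d => u; rewrite (mingens_equigen _ stair_set_deg); apply: stair_set_deg.
exists L.+1; first exact: analytic_spread_stair.
rewrite mon_ideal_pow mpowset2 msumset_stair mu_stair.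
by rewrite -mu_stair2 PoszD addrK.
Qed.

End StaircaseIdeal.

(** * The Borel ideals of the theorem *)

Section BorelGenerators.
Local Open Scope classical_set_scope.
Variables (n d m : nat) (r i : 'I_m -> nat).
Hypothesis m_gt0 : 0 < m.
Hypothesis hr : forall k, 1 <= r k <= d.
Hypothesis hi : forall k, 2 <= i k <= n.

Let u (k : 'I_m) : 'X_{1..n} :=
  (xvar n 1 *+ (d - r k) + xvar n 2 *+ (r k - 1) + xvar n (i k))%MM.

Let L := (\max_k i k).-1.

(** The height w_s: b can be as large as r_k - 1 next to a variable y_s of index
    at most i_k, and as large as r_k in absence of such a variable. *)
Definition column_height s := \max_(k | s.+1 < i k) r k + (s == 0).

Lemma tail_generator k t :
  tail (u k) t = (t < 1) * (d - r k) + (t < 2) * (r k - 1) + (t < i k).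
Proof.
have /andP[i2 i_n] := hi k; have n2 := leq_trans i2 i_n.
by rewrite /u !tailD !tailMn !tail_xvar // ltnW.
Qed.

Lemma mdeg_generator k : mdeg (u k) = d.
Proof.
rewrite -tail0 tail_generator /=; have := hr k; have /andP[i2 _] := hi k.
by rewrite (ltnW i2); lia.
Qed.

Lemma max_index : exists k, i k = L.+1.
Proof.
have [|k _ kE] := @eq_bigmax_cond _ predT i; first by rewrite card_ord.
by exists k; rewrite /L kE prednK //; have := hi k; lia.
Qed.

Lemma index_le k : i k <= L.+1.
Proof.
have [k1 k1E] := max_index; have := hi k1; have := leq_bigmax k : i k <= \max_k i k.
by rewrite k1E /L; case: (\max_k i k).
Qed.

Lemma column_height_witness s : s < L ->
  exists2 k, s.+1 < i k & column_height s = r k + (s == 0).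
Proof.
move=> sL; have [k1 k1E] := max_index.
have [|k kP kE] := @eq_bigmax_cond _ (fun k => s.+1 < i k) r.
  by apply/card_gt0P; exists k1; rewrite unfold_in k1E.
by exists k; rewrite // /column_height kE.
Qed.

Lemma column_height_ge s k : s.+1 < i k -> r k + (s == 0) <= column_height s.
Proof. by move=> sk; rewrite leq_add2r; apply: leq_bigmax_cond. Qed.

(** Below a generator the tails from x_3 on are at most 1, so they are the
    indicator of an initial segment; its end t0 locates the only variable beyond
    x_2, and the tails from x_1 and x_2 on then bound the exponent of x_2. *)
Lemma borel_below_generators_stair (a : 'X_{1..n}) :
  (mdeg a = d /\ exists2 v, range u v & forall t, tail a t <= tail v t) <->
  stair_set d L column_height a.
Proof.
split.
  move=> [da [_ [k _ <-] ak]]; have rk := hr k; have ik := hi k.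
  have ex0 : exists t, 0 < tail a t by exists 0; rewrite tail0 da; lia.
  have bnd t : 0 < tail a t -> t <= n.
    by move=> at0; have := ak t; rewrite tail_generator; lia.
  (* With variables numbered from 0, a has last variable x_t0; it is y_(t0-1)
     when t0 >= 2, and otherwise no variable beyond the second one occurs and
     the index is t0.-1 = 0 again. *)
  case: (ex_maxnP ex0 bnd) => t0 t0P t0max.
  have le1 t : 1 < t -> tail a t <= (t < i k).
    by move=> t1; have := ak t; rewrite tail_generator; lia.
  have tail_mono t t' : t <= t' -> tail a t' <= tail a t.
    move=> tt'; rewrite /tail [leqRHS](bigID (fun j : 'I_n => t' <= j)) /=.
    apply: leq_trans (leq_addr _ _); rewrite leq_eqVlt; apply/orP; left; apply/eqP.
    by apply: eq_bigl => j; rewrite andbC; case: leqP => // /(leq_trans tt') ->.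
  have tailE t : 1 < t -> tail a t = (t <= t0).
    move=> t1; case: leqP => [/tail_mono|t0t]; last first.
      by apply/eqP; rewrite -leqn0 leqNgt; apply/negP => /t0max; rewrite leqNgt t0t.
    by have := le1 t t1; case: (t < i k) => /=; lia.
  have a1 := ak 1; rewrite tail_generator /= in a1.
  have t0ik : t0.-1.+1 < i k.
    case: t0 t0P t0max tailE => [|[|t0]] t0P _ tailE; rewrite /= ?(andP ik).1 //.
    by have := le1 t0.+2 isT; rewrite tailE // leqnn; case: (_ < _).
  have a1t : (0 < t0.-1) <= tail a 1.
    case: t0 t0P {t0max tailE t0ik} => [|[|t0]] //= /leq_trans; apply.
    exact: tail_mono.
  have [n1 t0n] : 1 < n /\ t0.-1.+1 < n by lia.
  exists t0.-1, (tail a 1 - (0 < t0.-1)); split.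
  - by have := index_le k; lia.
  - by have := column_height_ge t0ik; move: (column_height _) => w; lia.
  - apply: tail_inj => -[|[|t]].
    + rewrite tail0 da tail_stair //= andbT mul1n mul1n addn0 subn0.
      by move: (nat_of_bool (0 < _)) a1t a1 => x; case: (1 < i k); lia.
    + by rewrite tail_stair //= andbT mul0n add0n mul1n addn0 subnK.
    + rewrite tail_stair // tailE //=.
      by case: t0 {t0P t0max tailE t0ik a1t t0n} => [|[|?]].
move=> [s [b [sL bw ->]]]; have [k ki kE] := column_height_witness sL.
have [rk ik] := (hr k, hi k); have kL := index_le k.
have bd : b + (0 < s) <= r k by move: bw; rewrite kE; case: (s) => [|?] /=; lia.
split; first by apply: mdeg_stair; rewrite /=; lia.
exists (u k) => [|t]; first by exists k.
by rewrite tail_generator tail_stair //; lia.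
Qed.

Lemma freiman_borel_generators (K : fieldType) :
  freiman (borel_hull K (range u)).
Proof.
rewrite (@borel_hull_equigen K n d) => [|_ [k _ <-]]; last exact: mdeg_generator.
set A := [set a | _]; have -> : A = stair_set d L column_height.
  by apply/seteqP; split=> a /(borel_below_generators_stair a).
have [k1 k1E] := max_index; have hk1 := hi k1.
have L_gt0 : 0 < L by lia.
apply: freiman_stair => //.
- by have := hr k1; lia.
- by lia.
- move=> s /column_height_witness[k _ ->]; have := hr k; lia.
- by have [k _ ->] := column_height_witness L_gt0; have := hr k; rewrite /=; lia.
- move=> s /column_height_witness[k _ ->]; have := hr k.
  by case: s => [|s] /=; lia.
Qed.

End BorelGenerators.

Theorem theorem2p2 (K : fieldType) (n d m : nat) (r i : 'I_m -> nat)
    (hn : 3 <= n) (hd : 3 <= d) (hm : 2 <= m)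
    (hr : forall k, 1 <= r k <= d) (hi : forall k, 2 <= i k <= n) :
  let u (k : 'I_m) : 'X_{1..n} :=
    (xvar n 1 *+ (d - r k) + xvar n 2 *+ (r k - 1) + xvar n (i k))%MM in
  freiman (borel_hull K [set u k | k in [set: 'I_m]]%classic).
Proof. by apply: freiman_borel_generators => //; apply: ltnW. Qed.
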